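(* Let $n$ be an odd positive integer. Then $mon_{n-1}(K_n\Box K_n)=\dfrac{n(n-1)}{2}$.
   Context: $K_n$ is the complete graph on $n$ vertices; $G\Box H$ is the Cartesian product (vertex set $V(G)\times V(H)$, $(u,v)\sim(u',v')$ iff $u=u'$ and $vv'\in E(H)$, or $v=v'$ and $uu'\in E(G)$). For a constant threshold $t$, a $t$-monopoly of a graph is a vertex set $M$ such that every vertex outside $M$ has at least $t$ neighbors in $M$; $mon_t$ is the minimum size of a $t$-monopoly. *)

(* Defs.v *)
From HB Require Import structures.
From mathcomp Require Import all_boot.

Set Implicit Arguments.
Unset Strict Implicit.
Unset Printing Implicit Defensive.

Record sgraph := SGraph {
  vertex :> finType;
  adj : rel vertex;
  adj_sym : symmetric adj;
  adj_irrefl : irreflexive adj }.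

Section Complete.
Variable n : nat.

Definition complete_adj : rel 'I_n := fun i j => i != j.

Lemma complete_sym : symmetric complete_adj.
Proof. by move=> i j; rewrite /complete_adj eq_sym. Qed.

Lemma complete_irrefl : irreflexive complete_adj.
Proof. by move=> i; rewrite /complete_adj eqxx. Qed.

Definition complete_graph : sgraph := SGraph complete_sym complete_irrefl.

End Complete.

Section CartesianProduct.
Variables G H : sgraph.

Definition cart_adj : rel (G * H)%type := fun x y =>
  ((x.1 == y.1) && adj x.2 y.2) || ((x.2 == y.2) && adj x.1 y.1).

Lemma cart_sym : symmetric cart_adj.
Proof.
move=> x y; rewrite /cart_adj (adj_sym x.1) (adj_sym x.2).
by rewrite (eq_sym x.1) (eq_sym x.2).
Qed.

Lemma cart_irrefl : irreflexive cart_adj.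
Proof. by move=> x; rewrite /cart_adj !adj_irrefl !andbF. Qed.

Definition cart_prod : sgraph := SGraph cart_sym cart_irrefl.

End CartesianProduct.

Definition neighbors (G : sgraph) (v : G) : {set G} := [set w | adj v w].

Definition monopoly (G : sgraph) (t : nat) (M : {set G}) : bool :=
  [forall v : G, (v \notin M) ==> (t <= #|neighbors v :&: M|)].

(* The full vertex set is always a t-monopoly, so the arg min below is a
   genuine minimum (see mon_min). *)
Lemma monopolyT (G : sgraph) (t : nat) : monopoly t [set: G].
Proof. by apply/forallP => v; rewrite inE. Qed.

Definition mon (t : nat) (G : sgraph) : nat :=
  #|[arg min_(M < [set: G] | monopoly t M) #|M|]|.

Lemma mon_min (G : sgraph) (t : nat) :
  (exists2 M : {set G}, monopoly t M & #|M| = mon t G) /\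
  (forall M : {set G}, monopoly t M -> mon t G <= #|M|).
Proof.
rewrite /mon; case: arg_minnP; first exact: monopolyT.
by move=> M monM minM; split => //; exists M.
Qed.

(* Main.v *)
Require Import Defs.
From mathcomp Require Import all_boot.
From mathcomp Require Import ssralg zmodp zify.

(** A vertex set [M] of the rook's graph is a 0-1 matrix, and a zero entry
    [(i, j)] has (row sum [i]) + (column sum [j]) neighbours in [M].  Put
    [n = 2k + 1].  The matrix with a one where [i + j mod n < k] has all line
    sums [k], which gives the upper bound.  Conversely let [r] be the least line
    sum, attained, say, by a row.  If [r >= k] we are done; otherwise the [n - r]
    columns meeting that row in a zero have sum at least [n - 1 - r], the other
    [r] columns have sum at least [r], and
    [(n - r) (n - 1 - r) + r ^ 2 >= k n] as soon as [r <= k]. *)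

Definition row_sum {n : nat} (A : 'I_n -> 'I_n -> bool) (i : 'I_n) : nat :=
  \sum_(j < n) A i j.

Definition col_sum {n : nat} (A : 'I_n -> 'I_n -> bool) (j : 'I_n) : nat :=
  \sum_(i < n) A i j.

Lemma sum_row_col n (A : 'I_n -> 'I_n -> bool) :
  \sum_(i < n) row_sum A i = \sum_(j < n) col_sum A j.
Proof. exact: exchange_big. Qed.

(** The case of the lower bound in which the row [i0] is a least line; a least column is handled by
    transposing [A]. *)
Lemma col_sums_ge {n k} (A : 'I_n -> 'I_n -> bool) (i0 : 'I_n) :
  n = k.*2.+1 ->
  (forall i j, ~~ A i j -> n - 1 <= row_sum A i + col_sum A j) ->
  (forall j, row_sum A i0 <= col_sum A j) ->
  k * n <= \sum_(j < n) col_sum A j.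
Proof.
move=> def_n monA minA; set r := row_sum A i0 in minA.
have [le_kr | lt_rk] := leqP k r.
  rewrite mulnC -[X in X * k]card_ord -sum_nat_const.
  by apply: leq_sum => j _; apply: leq_trans (minA j).
have card1 : #|[pred j | A i0 j]| = r by rewrite -sum1_card big_mkcond.
have card0 : #|[pred j | ~~ A i0 j]| = n - r.
  have := cardC [pred j | A i0 j].
  by rewrite card_ord card1 => card_n; rewrite -[in RHS]card_n addKn.
rewrite (bigID [pred j | A i0 j]) /=.
have ge1 : r * r <= \sum_(j | A i0 j) col_sum A j.
  by rewrite -{1}card1 -sum_nat_const leq_sum.
have ge0 : (n - r) * (n - 1 - r) <= \sum_(j | ~~ A i0 j) col_sum A j.
  rewrite -card0 -sum_nat_const; apply: leq_sum => j A0j.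
  by rewrite leq_subLR; apply: monA.
apply: leq_trans (leq_add ge1 ge0); rewrite {}def_n.
(* With [k = r + d] and [n = 2k + 1], the right side exceeds the left by [2d^2 + d]. *)
by rewrite -(subnKC (ltnW lt_rk)); move: (k - r) => d; nia.
Qed.

Lemma matrix_monopoly_ge {n k} {A : 'I_n -> 'I_n -> bool} :
  n = k.*2.+1 ->
  (forall i j, ~~ A i j -> n - 1 <= row_sum A i + col_sum A j) ->
  k * n <= \sum_(i < n) row_sum A i.
Proof.
case: n => // n in A * => def_n monA.
case: (arg_minnP (row_sum A) (erefl : xpredT (@ord0 n))) => i0 _ min_i.
case: (arg_minnP (col_sum A) (erefl : xpredT (@ord0 n))) => j0 _ min_j.
(* The hypothesis on zero entries is invariant under transposition, so the smaller of the least row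
   and the least column can play the role of the row [i0]. *)
have [le_ij | /ltnW le_ji] := leqP (row_sum A i0) (col_sum A j0).
  rewrite sum_row_col; apply: (col_sums_ge A i0) => // j.
  exact: leq_trans le_ij (min_j j isT).
apply: (col_sums_ge (fun i j => A j i) j0) => // [i j Aij | j].
  by rewrite addnC; apply: monA.
exact: leq_trans le_ji (min_i j isT).
Qed.

Section RookGraph.

Context {n : nat}.
Let G := cart_prod (complete_graph n) (complete_graph n).
Implicit Type M : {set G}.

Definition rook_matrix M : 'I_n -> 'I_n -> bool := fun i j => (i, j) \in M.

Lemma card_rook M : #|M| = \sum_(i < n) row_sum (rook_matrix M) i.
Proof.
rewrite -sum1_card big_mkcond /row_sum pair_big /=.
by apply: eq_bigr => -[i j] _.
Qed.

(** The row and the column through [(i, j)] meet only in that vertex. As it lies outside [M], the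
    two sums count disjoint sets and neither counts the vertex itself. *)
Lemma card_rook_neighbors M (i j : 'I_n) : (i, j) \notin M ->
  #|neighbors ((i, j) : G) :&: M|
    = row_sum (rook_matrix M) i + col_sum (rook_matrix M) j.
Proof.
move=> Mij.
pose P := [set j' : 'I_n | (i, j') \in M].
pose Q := [set i' : 'I_n | (i', j) \in M].
have -> : row_sum (rook_matrix M) i = #|P|.
  by rewrite -sum1_card big_mkcond; apply: eq_bigr => j' _; rewrite inE.
have -> : col_sum (rook_matrix M) j = #|Q|.
  by rewrite -sum1_card big_mkcond; apply: eq_bigr => i' _; rewrite inE.
have injP : injective (fun j' : 'I_n => (i, j')) by move=> ? ? [].
have injQ : injective (fun i' : 'I_n => (i', j)) by move=> ? ? [].
have PQ0 : [set (i, j') | j' in P] :&: [set (i', j) | i' in Q] = set0.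
  apply/setP=> x; rewrite in_set0; apply/negP=> /setIP[].
  case/imsetP=> j' Pj' -> /imsetP[i' _ [_ def_j]].
  by rewrite inE def_j (negPf Mij) in Pj'.
rewrite -(card_imset P injP) -(card_imset Q injQ) -cardsUI PQ0 cards0 addn0.
apply: eq_card => -[a b]; rewrite !inE /= /cart_adj /= /complete_adj.
apply/andP/orP => [[/orP[] /andP[/eqP <- _] Mab] | [] /imsetP[c]].
- by left; apply: imset_f; rewrite inE.
- by right; apply: imset_f; rewrite inE.
- rewrite inE => Mic [-> ->]; rewrite eqxx Mic; split=> //.
  by apply/orP; left; apply: contraNneq Mij => ->.
- rewrite inE => Mcj [-> ->]; rewrite eqxx Mcj; split=> //.
  by apply/orP; right; apply: contraNneq Mij => ->.
Qed.

Lemma rook_monopolyP {t M} :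
  reflect (forall i j, ~~ rook_matrix M i j ->
             t <= row_sum (rook_matrix M) i + col_sum (rook_matrix M) j)
          (monopoly t M).
Proof.
apply: (iffP forallP) => monM => [i j Mij | [i j]].
  by rewrite -card_rook_neighbors //; apply: (implyP (monM (i, j))).
by apply/implyP=> Mij; rewrite card_rook_neighbors //; apply: monM.
Qed.

End RookGraph.

Lemma sum_ord_lt {n k} : k <= n -> \sum_(j < n) (j < k : nat) = k.
Proof.
move=> le_kn; rewrite -[RHS]card_ord -sum1_card (big_ord_widen n (fun=> 1)) //.
by rewrite [RHS]big_mkcond.
Qed.

(** Here [i + j] is addition modulo [n.+1], so translation by [i] permutes the indices. *)
Lemma sum_ord_shift_lt {n k} (i : 'I_n.+1) :
  k <= n.+1 -> \sum_(j < n.+1) ((i + j)%R < k : nat) = k.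
Proof.
by move=> le_kn; rewrite -{2}(sum_ord_lt le_kn) [RHS](reindex_inj (GRing.addrI i)).
Qed.

Theorem theorem5 (n : nat) (hn : odd n) :
  mon (n - 1) (cart_prod (complete_graph n) (complete_graph n))
  = n * (n - 1) %/ 2.
Proof.
have [k def_n] : exists k, n = k.*2.+1.
  by exists n./2; rewrite -[LHS]odd_double_half hn.
have -> : n * (n - 1) %/ 2 = k * n.
  by rewrite {}def_n subn1 /= -muln2 mulnA mulnK // mulnC.
case: (mon_min (cart_prod (complete_graph n) (complete_graph n)) (n - 1)).
move=> [M monM cardM] minM; apply/eqP; rewrite eqn_leq; apply/andP; split.
  (* Upper bound. The successor form gives ['I_m.+1] its addition modulo [m.+1]. *)
  case: n def_n {hn M monM cardM} minM => // m def_n minM.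
  have le_km : k <= m.+1 by lia.
  pose B : {set cart_prod (complete_graph m.+1) (complete_graph m.+1)} :=
    [set v : 'I_m.+1 * 'I_m.+1 | (v.1 + v.2)%R < k].
  have rowB i : row_sum (rook_matrix B) i = k.
    rewrite -[RHS](sum_ord_shift_lt i le_km).
    by apply: eq_bigr => j _; rewrite /rook_matrix inE.
  have colB j : col_sum (rook_matrix B) j = k.
    rewrite -[RHS](sum_ord_shift_lt j le_km).
    by apply: eq_bigr => i _; rewrite /rook_matrix inE [in RHS]GRing.addrC.
  have /minM : monopoly (m.+1 - 1) B.
    (* The threshold is met with equality: [k + k = m.+1 - 1]. *)
    by apply/rook_monopolyP => i j _; rewrite rowB colB; lia.
  rewrite card_rook (eq_bigr _ (fun i _ => rowB i)).
  by rewrite sum_nat_const card_ord mulnC.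
rewrite -cardM card_rook; apply: matrix_monopoly_ge def_n _.
exact/rook_monopolyP.
Qed.
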